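(* Let $r\geq 1$ be an integer. There exists $n_0$ such that for every $n\geq n_0$ with $(r+1)\mid n$, the following holds, where $F = \frac{n}{r+1}K_{r+1}$ is the disjoint union of $n/(r+1)$ copies of $K_{r+1}$: if $G$ is an $n$-vertex graph not containing $F$ as a subgraph, then $\lambda(G) \leq \lambda(H_{n,r})$, with equality if and only if $G \cong H_{n,r}$.
   Context: All graphs are finite and simple. $\lambda(G)$ denotes the largest eigenvalue of the adjacency matrix of $G$. For integers $n>m\geq 1$, $H_{n,m} = K_{m-1} \vee (K_{n-m} \cup K_1)$, i.e. an $(n-1)$-clique plus one vertex adjacent to exactly $m-1$ vertices of the clique ($\vee$ is the join, $\cup$ the disjoint union). *)

(* Defs.v *)
From HB Require Import structures.
From mathcomp Require Import all_boot all_order all_algebra all_fingroup.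
From mathcomp Require Import reals polyrcf.
Set Implicit Arguments. Unset Strict Implicit. Unset Printing Implicit Defensive.
Import Order.TTheory GRing.Theory Num.Theory.
Local Open Scope ring_scope.

Definition simple_graph (V : finType) (adj : rel V) : Prop :=
  symmetric adj /\ irreflexive adj.

Definition adj_mx (R : realType) (n : nat) (adj : rel 'I_n) : 'M[R]_n :=
  \matrix_(i, j) (adj i j)%:R.

(* The largest eigenvalue of a real square matrix: the maximum of the real
   roots of its characteristic polynomial (real roots of char_poly A are
   exactly the eigenvalues of A over R, cf. mxpoly.eigenvalue_root_char).
   For a real symmetric matrix of positive size the list is nonempty. *)
Definition lambda_max (R : realType) (n : nat) (A : 'M[R]_n) : R :=
  let s := rootsR (char_poly A) in \big[Num.max/head 0%R s]_(x <- s) x.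

Definition lambda (R : realType) (n : nat) (adj : rel 'I_n) : R :=
  lambda_max (adj_mx R adj).

(* H_{n,m} = K_{m-1} \vee (K_{n-m} \cup K_1) on vertex set 'I_n:
   the vertex n-1 is the K_1, adjacent exactly to the vertices 0..m-2
   (these form the K_{m-1}); all vertices other than n-1 are pairwise
   adjacent (they form the clique K_{m-1} \vee K_{n-m} = K_{n-1}). *)
Definition H_adj (n m : nat) : rel 'I_n :=
  fun i j =>
    (i != j) &&
    (if (i : nat) == n.-1 then (j < m.-1)%N
     else if (j : nat) == n.-1 then (i < m.-1)%N
     else true).

Definition copies_of_K (k s : nat) : rel ('I_k * 'I_s) :=
  fun u v => (u.1 == v.1) && (u.2 != v.2).

Definition contains_subgraph (VF VG : finType) (F : rel VF) (G : rel VG) : Prop :=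
  exists f : VF -> VG, injective f /\ forall u v, F u v -> G (f u) (f v).

Definition graph_iso (V : finType) (G H : rel V) : Prop :=
  exists f : {perm V}, forall u v, G u v = H (f u) (f v).

(* Main.v *)
Require Import Defs.
From HB Require Import structures.
From mathcomp Require Import all_boot all_order all_algebra all_fingroup.
From mathcomp Require Import reals polyrcf.
From mathcomp Require boolp classical_sets topology normedtype derive.
From mathcomp Require Import ring lra zify.
Import Order.TTheory GRing.Theory Num.Theory.
Set Implicit Arguments. Unset Strict Implicit. Unset Printing Implicit Defensive.
Local Open Scope ring_scope.

(** Let [D] be the complement of [G], and suppose that
    [lambda G >= lambda H_{n,r} >= n - 2].  If the Perron vector [x] of [G] is
    scaled to have maximum 1, the eigenvalue equation
    [(lambda + 1) x_v = sum x - sum_{u in N_D(v)} x_u] at a maximal entry gives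
    [sum (1 - x_u) <= 1]; summing it over [v] shows that [D] has at most [n - 1]
    edges.

    If every vertex [v] has a clique of size [r] in its [G]-neighbourhood, [G]
    contains the factor: cover first a vertex of maximum [D]-degree, then
    greedily the other vertices of large [D]-degree (which is at most [n/2],
    as [D] has few edges), and tile the remaining vertices by local exchanges.

    Otherwise some [v] has no [r]-clique in its neighbourhood [N].  Then [N] is
    small, so [x_v] is less than half of any other entry.  Take a maximal clique
    [M] in [N], delete the edges from [v] to [N \ M] and complete [G - v] to a
    clique.  Each lost edge [vi] is paid for by a gained edge [iw], [w] in [M],
    hence the Rayleigh quotient at [x] does not decrease, while the new graph is
    contained in a copy of [H_{n,r}]. *)

(** * Largest eigenvalue and Rayleigh quotients *)

Definition qform (R : pzRingType) n (A : 'M[R]_n) (x : 'I_n -> R) : R :=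
  \sum_i x i * \sum_j A i j * x j.

Definition sqnorm (R : pzRingType) n (x : 'I_n -> R) : R := \sum_i x i ^+ 2.

Lemma sqnorm_ge0 (R : realDomainType) n (x : 'I_n -> R) : 0 <= sqnorm x.
Proof. by apply: sumr_ge0 => i _; exact: sqr_ge0. Qed.

Lemma sqnorm_eq0 (R : realDomainType) n (x : 'I_n -> R) :
  sqnorm x = 0 -> forall i, x i = 0.
Proof.
move=> /eqP; rewrite psumr_eq0 => [/allP x0 i|i _]; last exact: sqr_ge0.
by have := x0 i (mem_index_enum _); rewrite /= sqrf_eq0 => /eqP.
Qed.

Lemma qform_eigen (R : comPzRingType) n (A : 'M[R]_n) mu (x : 'I_n -> R) :
  (forall i, \sum_j A i j * x j = mu * x i) -> qform A x = mu * sqnorm x.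
Proof.
move=> Ax; rewrite /qform /sqnorm mulr_sumr; apply: eq_bigr => i _.
by rewrite Ax mulrCA expr2.
Qed.

Lemma qformZ (R : comPzRingType) n (A : 'M[R]_n) c (x : 'I_n -> R) :
  qform A (fun i => c * x i) = c ^+ 2 * qform A x.
Proof.
rewrite /qform mulr_sumr; apply: eq_bigr => i _.
rewrite expr2 -!mulrA; congr (c * _); rewrite mulrCA; congr (x i * _).
by rewrite mulr_sumr; apply: eq_bigr => j _; rewrite mulrCA.
Qed.

Lemma sqnormZ (R : comPzRingType) n c (x : 'I_n -> R) :
  sqnorm (fun i => c * x i) = c ^+ 2 * sqnorm x.
Proof. by rewrite /sqnorm mulr_sumr; apply: eq_bigr => i _; rewrite exprMn. Qed.

Section Compactness.
Import classical_sets topology normedtype derive numFieldNormedType.Exports.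

(** The form is continuous and the unit sphere is compact, as a closed part of a cube. Homogeneity
    extends the bound to all vectors, the zero vector being treated apart. *)
Lemma rayleigh_max (R : realType) n (A : 'M[R]_n.+1) :
  exists x : 'I_n.+1 -> R, sqnorm x = 1 /\
    forall y, qform A y <= qform A x * sqnorm y.
Proof.
pose f (v : 'rV[R]_n.+1) := qform A (v ord0).
pose g (v : 'rV[R]_n.+1) := sqnorm (v ord0).
have cts_coord i : continuous (fun v : 'rV[R]_n.+1 => v ord0 i).
  exact: coord_continuous.
have cts_g : continuous g.
  apply: continuous_big => [|i _ v]; first exact: add_continuous.
  exact: (cvgM (cts_coord i v) (cts_coord i v)).
have cts_f : continuous f.
  apply: continuous_big => [|i _ v]; first exact: add_continuous.
  apply: (cvgM (cts_coord i v)); move: v.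
  apply: continuous_big => [|j _ v]; first exact: add_continuous.
  exact: (cvgM (cvg_cst _) (cts_coord j v)).
pose S := (g @^-1` [set 1])%classic.
have [v Sv vmax] : exists2 c, c \in S & forall t, t \in S -> f t <= f c.
  apply: EVT_max_rV.
  - exists (delta_mx ord0 ord0); rewrite /S /= /g /sqnorm (bigD1 ord0) //=.
    rewrite mxE !eqxx expr1n big1 ?addr0 // => i /negPf i0.
    by rewrite mxE i0 andbF expr0n.
  - have Scl : closed S by apply: preimage_closed => //; exact: closed_eq.
    have cube := @rV_compact R n.+1 (fun=> `[-1, 1]%classic)
      (fun _ => @segment_compact R (-1) 1).
    apply: (subclosed_compact Scl cube).
    move=> w Sw i /=; rewrite in_itv /= -ler_norml -(@ler_pXn2r _ 2) ?nnegrE //.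
    rewrite expr1n -normrX ger0_norm ?sqr_ge0 // -Sw /g /sqnorm (bigD1 i) //=.
    by rewrite lerDl sumr_ge0 // => j _; exact: sqr_ge0.
  - by apply: continuous_subspaceT.
have gv : sqnorm (v ord0) = 1 by move: Sv; rewrite inE.
exists (v ord0); split=> // y; have [y0|y0] := eqVneq (sqnorm y) 0.
  rewrite y0 mulr0 /qform big1 // => i _.
  by rewrite (sqnorm_eq0 y0) mul0r.
have yp : 0 < sqnorm y by rewrite lt_def y0 sqnorm_ge0.
pose c := (Num.sqrt (sqnorm y))^-1.
have c2 : c ^+ 2 = (sqnorm y)^-1 by rewrite exprVn sqr_sqrtr // ltW.
pose w : 'rV[R]_n.+1 := \row_i (c * y i).
have wE : w ord0 =1 (fun i => c * y i) by move=> i; rewrite mxE.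
have gw : sqnorm (w ord0) = c ^+ 2 * sqnorm y.
  by rewrite -sqnormZ; apply: eq_bigr => i _; rewrite wE.
have fw : qform A (w ord0) = c ^+ 2 * qform A y.
  rewrite -qformZ; apply: eq_bigr => i _; rewrite wE; congr (_ * _).
  by apply: eq_bigr => j _; rewrite wE.
have := vmax w; rewrite inE /S /= /g /f gw fw c2 mulVf //.
by move=> /(_ erefl); rewrite ler_pdivrMl // mulrC.
Qed.

End Compactness.

(** First variation in the direction [b = A x - mu x]: moving [x] by [t * b] gains
    [2 * t * sqnorm b] against the bound and loses only a multiple of [t ^+ 2], so [b] vanishes. *)
Lemma rayleigh_eq_eigen (R : realFieldType) n (A : 'M[R]_n) mu (x : 'I_n -> R) :
    A^T = A -> (forall y, qform A y <= mu * sqnorm y) ->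
    qform A x = mu * sqnorm x ->
  forall i, \sum_j A i j * x j = mu * x i.
Proof.
move=> symA bound eqx.
pose b i := \sum_j A i j * x j - mu * x i.
suff: sqnorm b = 0.
  by move=> /sqnorm_eq0 b0 i; have := b0 i => /eqP; rewrite subr_eq0 => /eqP.
have qfD t : qform A (fun i => x i + t * b i) =
    qform A x + 2 * t * (\sum_i b i * \sum_j A i j * x j) + t ^+ 2 * qform A b.
  have sym : \sum_i x i * (\sum_j A i j * b j) = \sum_i b i * \sum_j A i j * x j.
    under eq_bigr do rewrite mulr_sumr.
    rewrite exchange_big; apply: eq_bigr => i _; rewrite mulr_sumr.
    apply: eq_bigr => j _; have /matrixP/(_ i j) := symA; rewrite mxE => ->; ring.
  have -> : qform A (fun i => x i + t * b i) = \sum_i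
     (x i * (\sum_j A i j * x j) + t * (x i * (\sum_j A i j * b j))
      + t * (b i * \sum_j A i j * x j) + t ^+ 2 * (b i * \sum_j A i j * b j)).
    apply: eq_bigr => i _.
    have -> : \sum_j A i j * (x j + t * b j) =
              \sum_j A i j * x j + t * \sum_j A i j * b j.
      by rewrite mulr_sumr -big_split; apply: eq_bigr => j _ /=; ring.
    by ring.
  by rewrite !big_split /= -!mulr_sumr sym /qform; ring.
have sqD t : sqnorm (fun i => x i + t * b i) =
    sqnorm x + 2 * t * (\sum_i b i * x i) + t ^+ 2 * sqnorm b.
  rewrite /sqnorm !mulr_sumr -!big_split; apply: eq_bigr => i _ /=; ring.
have bE : sqnorm b = (\sum_i b i * \sum_j A i j * x j) - mu * \sum_i b i * x i.
  rewrite mulr_sumr -sumrB; apply: eq_bigr => i _.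
  by rewrite {1}/b expr2 -/(b i) {2}/b; ring.
have s0 := sqnorm_ge0 b.
have c0 : 0 <= mu * sqnorm b - qform A b by rewrite subr_ge0.
set s := sqnorm b in bE s0 c0 *; set c := mu * s - qform A b in c0.
have key t : 2 * t * s <= t ^+ 2 * c.
  have := bound (fun i => x i + t * b i); rewrite qfD sqD eqx -/s.
  by rewrite [X in 2 * t * X <= _]bE /c; lra.
have cp : 0 < c + 1 by lra.
have c1 := lt0r_neq0 cp.
(* The denominator is [c + 1] rather than [c] because [c] may be 0. *)
have := key (s / (c + 1)).
have -> : 2 * (s / (c + 1)) * s = (2 * s ^+ 2 * (c + 1)) / (c + 1) ^+ 2 by field.
have -> : (s / (c + 1)) ^+ 2 * c = (s ^+ 2 * c) / (c + 1) ^+ 2 by field.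
rewrite ler_pM2r; last by rewrite invr_gt0 exprn_gt0.
move=> h; apply/eqP; rewrite -sqrf_eq0; apply/eqP; nra.
Qed.

(** Ties the definition by roots of the characteristic polynomial to the variational one: [mu] is a
    root because of [x], and any root is the Rayleigh quotient of one of its eigenvectors, hence at
    most [mu]. *)
Lemma lambda_maxE (R : realType) n (A : 'M[R]_n) mu (x : 'I_n -> R) i :
    A^T = A -> (forall y, qform A y <= mu * sqnorm y) ->
    (forall i, \sum_j A i j * x j = mu * x i) -> x i != 0 ->
  lambda_max A = mu.
Proof.
move=> symA bound eigx xi.
have eigE a (v : 'rV_n) :
    v *m A = a *: v <-> forall i, \sum_j A i j * v ord0 j = a * v ord0 i.
  have vA k : (v *m A) ord0 k = \sum_j A k j * v ord0 j.
    rewrite mxE; apply: eq_bigr => j _; rewrite mulrC; congr (_ * _).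
    by have /matrixP/(_ j k) := symA; rewrite mxE.
  by split=> [/rowP vE k|h]; [have := vE k|apply/rowP => k]; rewrite vA mxE.
have rootE a : (a \in rootsR (char_poly A)) = eigenvalue A a.
  rewrite eigenvalue_root_char -roots_on_rootsR ?in_itv //.
  by rewrite monic_neq0 ?char_poly_monic.
have muin : mu \in rootsR (char_poly A).
  rewrite rootE; apply/eigenvalueP; exists (\row_i x i).
    apply/eigE => k; rewrite mxE -eigx.
    by apply: eq_bigr => j _; rewrite mxE.
  by apply/eqP => /rowP/(_ i); rewrite !mxE; exact/eqP.
have muge a : a \in rootsR (char_poly A) -> a <= mu.
  rewrite rootE => /eigenvalueP[v /eigE va v0].
  have := bound (v ord0); rewrite (qform_eigen va) ler_pM2r //.
  rewrite lt_def sqnorm_ge0 andbT; apply: contraNN v0 => /eqP/sqnorm_eq0 v0.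
  by apply/eqP/rowP => k; rewrite mxE.
rewrite /lambda_max; apply/eqP; rewrite eq_le; apply/andP; split.
  rewrite big_seq; apply: (big_ind (fun a => a <= mu)) => //.
    (* The default of the maximum is the head of the list, itself a root since [mu] makes the list
       nonempty. *)
    by apply: muge; case: (rootsR _) muin => // a s _; rewrite mem_head.
  by move=> a b amu bmu; rewrite ge_max amu bmu.
exact: (@Order.TotalTheory.le_bigmax_seq _ _ _ _ _ mu xpredT id).
Qed.

(** As [A] is nonnegative, the entrywise absolute value of a maximiser is again a maximiser, hence
    an eigenvector; it is then divided by its largest entry. *)
Lemma lambda_max_perron (R : realType) n (A : 'M[R]_n.+1) :
    A^T = A -> (forall i j, 0 <= A i j) ->
  (forall y, qform A y <= lambda_max A * sqnorm y) /\
  exists x : 'I_n.+1 -> R, [/\ forall i, 0 <= x i <= 1, exists i, x i = 1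
    & forall i, \sum_j A i j * x j = lambda_max A * x i].
Proof.
move=> symA A0; have [x [x1 xmax]] := rayleigh_max A.
set mu := qform A x in xmax.
pose z i := `|x i|.
have z1 : sqnorm z = 1.
  by rewrite -x1; apply: eq_bigr => i _; rewrite -normrX ger0_norm ?sqr_ge0.
have zmax : qform A z = mu * sqnorm z.
  apply/eqP; rewrite eq_le xmax z1 mulr1 /mu /qform; apply: ler_sum => i _.
  rewrite (le_trans (ler_norm _)) // normrM ler_wpM2l //.
  rewrite (le_trans (ler_norm_sum _ _ _)) //; apply: ler_sum => j _.
  by rewrite normrM ger0_norm.
have eigz := rayleigh_eq_eigen symA xmax zmax.
have [m mmax] : exists m, forall i, z i <= z m.
  have [m _ mm] := @arg_maxP _ _ _ ord0 predT z erefl.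
  by exists m => i; exact: mm.
have zm : 0 < z m.
  rewrite lt_def normr_ge0 andbT; apply/eqP => zm0.
  have : sqnorm z = 0.
    apply: big1 => i _; have := mmax i; rewrite zm0 normr_le0 => /eqP xi0.
    by rewrite /z xi0 normr0 expr0n.
  by rewrite z1 => /eqP; rewrite oner_eq0.
rewrite (lambda_maxE symA xmax eigz (lt0r_neq0 zm)); split=> //.
exists (fun i => z i / z m); split.
- by move=> i; rewrite divr_ge0 ?normr_ge0 //= ler_pdivrMr // mul1r.
- by exists m; rewrite divff ?lt0r_neq0.
- move=> i; rewrite mulrA -eigz mulr_suml.
  by apply: eq_bigr => j _; rewrite mulrA.
Qed.

(** * Tilings by independent sets *)

Local Open Scope nat_scope.

Section Tilings.
Variables (V : finType) (e : rel V).
Hypotheses (sym_e : symmetric e) (irr_e : irreflexive e).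

Definition degree (v : V) : nat := #|[set u | e v u]|.

Definition independent (I : {set V}) : Prop := {in I &, forall x y, ~~ e x y}.

(** Encoded by an injection from the vertices of [copies_of_K], so that for [e] the complement of a
    graph and [W] everything it is an embedding of the clique factor. *)
Definition tiled (s : nat) (W : {set V}) : Prop :=
  exists k (f : 'I_k * 'I_s -> V),
    [/\ injective f, f @: setT = W
      & forall p q, copies_of_K p q -> ~~ e (f p) (f q)].

Lemma tiled_card s W : tiled s W -> s %| #|W|.
Proof.
move=> [k [f [injf <- _]]]; rewrite card_imset // cardsT card_prod !card_ord.
exact: dvdn_mull.
Qed.

Lemma tiled_independent (I : {set V}) : independent I -> tiled #|I| I.
Proof.
move=> indI; exists 1, (fun p => enum_val p.2); split.
- by move=> [a b] [c d] /= /enum_val_inj ->; rewrite (ord1 a) (ord1 c).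
- apply/setP => x; apply/imsetP/idP => [[p _ ->]|xI]; first exact: enum_valP.
  by exists (ord0, enum_rank_in xI x) => //=; rewrite enum_rankK_in.
- by move=> p q _; apply: indI; exact: enum_valP.
Qed.

Lemma tiledU s W1 W2 :
  tiled s W1 -> tiled s W2 -> [disjoint W1 & W2] -> tiled s (W1 :|: W2).
Proof.
move=> [k1 [f1 [inj1 im1 e1]]] [k2 [f2 [inj2 im2 e2]]] dW.
pose f (p : 'I_(k1 + k2) * 'I_s) :=
  match split p.1 with inl i => f1 (i, p.2) | inr i => f2 (i, p.2) end.
have in1 p : f1 p \in W1 by rewrite -im1 imset_f.
have in2 p : f2 p \in W2 by rewrite -im2 imset_f.
have ne12 p q : f1 p <> f2 q.
  move=> pq; have := in1 p; rewrite pq => /(disjointFr dW).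
  by rewrite in2.
have fl i j : f (lshift k2 i, j) = f1 (i, j) by rewrite /f /= -[lshift _ _]/(unsplit (inl i)) unsplitK.
have fr i j : f (rshift k1 i, j) = f2 (i, j) by rewrite /f /= -[rshift _ _]/(unsplit (inr i)) unsplitK.
exists (k1 + k2), f; split.
- move=> [a b] [c d]; rewrite -(splitK a) -(splitK c).
  case: (split a) => a'; case: (split c) => c' /=; rewrite ?fl ?fr.
  + by move=> /inj1[-> ->].
  + by move=> /ne12.
  + by move=> /esym/ne12.
  + by move=> /inj2[-> ->].
- apply/setP => x; rewrite in_setU -im1 -im2; apply/imsetP/orP.
    move=> [[a b] _ ->]; rewrite -(splitK a).
    by case: (split a) => a' /=; [left; rewrite fl|right; rewrite fr];
      exact: imset_f.
  by move=> [] /imsetP[[a b] _ ->]; [exists (lshift k2 a, b)|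
    exists (rshift k1 a, b)]; rewrite ?fl ?fr.
- move=> [a b] [c d]; rewrite /copies_of_K /= -(splitK a) -(splitK c).
  case: (split a) => a'; case: (split c) => c' /=; rewrite ?fl ?fr.
  + by rewrite eq_lshift => h; exact: e1.
  + by rewrite eq_lrshift.
  + by rewrite eq_rlshift.
  + by rewrite eq_rshift => h; exact: e2.
Qed.

(** Greedy choice: each chosen vertex rules out itself and at most [T] others. *)
Lemma independent_subset (T r : nat) (C : {set V}) :
    {in C, forall v, degree v <= T} -> r * T.+1 <= #|C| ->
  exists I : {set V}, [/\ I \subset C, #|I| = r & independent I].
Proof.
elim: r C => [|r IHr] C degC cardC.
  exists set0; split; rewrite ?sub0set ?cards0 // => x y.
  by rewrite in_set0.
have /set0Pn[v vC] : C != set0 by rewrite -card_gt0; lia.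
pose N := v |: [set u | e v u].
have cN : #|N| <= T.+1.
  by rewrite cardsU1 inE irr_e /=; have := degC v vC; rewrite /degree; lia.
have [||I [IC cI indI]] := IHr (C :\: N).
- by move=> u /setDP[uC _]; exact: degC.
- have := cardsID N C; have := subset_leq_card (subsetIr C N); nia.
have vI : v \notin I.
  by apply/negP => /(subsetP IC); rewrite !inE eqxx.
exists (v |: I); split.
- by rewrite subUset sub1set vC (subset_trans IC) ?subsetDl.
- by rewrite cardsU1 vI cI.
- have vN u : u \in I -> ~~ e v u.
    by move=> /(subsetP IC); rewrite !inE; case: (e v u); rewrite ?orbT.
  move=> x y; rewrite !inE => /orP[/eqP->|xI] /orP[/eqP->|yI].
  + by rewrite irr_e.
  + exact: vN.
  + by rewrite sym_e vN.
  + exact: indI.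
Qed.

Lemma card_preim_nbh (X : finType) (f : X -> V) v :
  injective f -> #|[set x | e v (f x)]| <= degree v.
Proof.
move=> injf; rewrite -(card_imset _ injf); apply: subset_leq_card.
by apply/subsetP => _ /imsetP[x + ->]; rewrite !inE.
Qed.

Lemma card_bigcup_leq (I T : finType) (A : {set I}) (F : I -> {set T}) m :
  {in A, forall i, #|F i| <= m} -> #|\bigcup_(i in A) F i| <= #|A| * m.
Proof.
move=> Fm; rewrite -sum_nat_const.
elim/big_rec2: _ => [|i l B iA IH]; first by rewrite cards0.
by rewrite (leq_trans (leq_card_setU _ _).1) // leq_add ?Fm.
Qed.

Lemma card_row k s (i : 'I_k) : #|[set p : 'I_k * 'I_s | p.1 == i]| = s.
Proof.
have -> : [set p : 'I_k * 'I_s | p.1 == i] = setX [set i] setT.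
  by apply/setP => p; rewrite !inE andbT.
by rewrite cardsX cards1 cardsT card_ord mul1n.
Qed.

(* Take a bijection onto [W] with fewest edges inside blocks.  If [a] lies on
   such an edge, exchanging [a] with a position [b] that avoids the few
   forbidden ones creates no new edge and destroys this one. *)
Lemma tiled_low_degree (T k s : nat) (W : {set V}) :
    #|W| = k * s -> {in W, forall v, degree v <= T} ->
    s + 2 * (s * T) < #|W| ->
  tiled s W.
Proof.
move=> cW degW big.
pose X := ('I_k * 'I_s)%type.
have cX : #|{: X}| = #|W| by rewrite card_prod !card_ord cW.
pose P (f : {ffun X -> V}) := injectiveb f && (f @: setT == W).
pose bad (f : {ffun X -> V}) :=
  [set p : X * X | copies_of_K p.1 p.2 && e (f p.1) (f p.2)].
pose f0 : {ffun X -> V} := [ffun x => enum_val (cast_ord cX (enum_rank x))].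
have Pf0 : P f0.
  have injf0 : injective f0.
    by move=> x y; rewrite !ffunE => /enum_val_inj/cast_ord_inj/enum_rank_inj.
  apply/andP; split; first exact/injectiveP.
  rewrite eqEcard card_imset // cardsT cX leqnn andbT.
  by apply/subsetP => _ /imsetP[x _ ->]; rewrite ffunE enum_valP.
case: (arg_minnP (fun f => #|bad f|) Pf0) => f /andP[/injectiveP injf /eqP imf] fmin.
exists k, f; split=> // a a' aa'; apply/negP => eaa'.
have inW x : f x \in W by rewrite -imf imset_f.
(* Forbidden positions: the block of [a], the positions whose vertex is adjacent to some vertex of
   that block, and the blocks holding a neighbour of [f a]. They number at most
   [s + 2 * (s * T)]. *)
pose F1 := [set b : X | b.1 == a.1].
pose F2 := \bigcup_(c in F1) [set b | e (f c) (f b)].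
pose F3 := \bigcup_(b' in [set b' | e (f a) (f b')]) [set b : X | b.1 == b'.1].
have cF1 : #|F1| = s by exact: card_row.
have cF2 : #|F2| <= s * T.
  suff: #|F2| <= #|F1| * T by rewrite cF1.
  apply: card_bigcup_leq => c _.
  exact: leq_trans (card_preim_nbh _ injf) (degW _ (inW c)).
have cF3 : #|F3| <= T * s.
  apply: (@leq_trans (#|[set b' | e (f a) (f b')]| * s)).
    by apply: card_bigcup_leq => b _; rewrite card_row.
  rewrite leq_mul2r; apply/orP; right.
  exact: leq_trans (card_preim_nbh _ injf) (degW _ (inW a)).
have [b] : exists b, b \notin F1 :|: F2 :|: F3.
  apply/existsP; rewrite -negb_forall; apply/negP => /forallP all_in.
  have : #|{: X}| <= #|F1 :|: F2 :|: F3|.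
    by apply/subset_leq_card/subsetP => x _; exact: all_in.
  have := (leq_card_setU (F1 :|: F2) F3).1; have := (leq_card_setU F1 F2).1.
  by rewrite cX; lia.
rewrite !in_setU !negb_or -andbA => /and3P[nF1 nF2 nF3].
have ab : b.1 != a.1 by move: nF1; rewrite inE.
have ne_b c : c.1 == a.1 -> ~~ e (f c) (f b).
  move=> ca; apply: contraNN nF2 => ecb; apply/bigcupP.
  by exists c; rewrite inE.
have ne_a c : c.1 == b.1 -> ~~ e (f a) (f c).
  move=> cb; apply: contraNN nF3 => eac; apply/bigcupP.
  by exists c; rewrite inE // eq_sym.
pose f' : {ffun X -> V} := [ffun x => f (tperm a b x)].
have Pf' : P f'.
  have injf' : injective f' by move=> x y; rewrite !ffunE => /injf/perm_inj.
  apply/andP; split; first exact/injectiveP.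
  rewrite eqEcard -imf !card_imset // leqnn andbT.
  by apply/subsetP => _ /imsetP[x _ ->]; rewrite ffunE imset_f.
(* After the exchange no bad pair meets [a] or [b], and pairs elsewhere are unchanged; the pair
   [(a, a')] is no longer bad, against minimality. *)
have := fmin f' Pf'; rewrite leqNgt => /negP; apply; apply: proper_card.
have nab (c d : X) : c.1 == d.1 -> c == a -> d == b = false.
  by move=> cd /eqP ca; apply: contraNF ab => /eqP <-; rewrite -ca eq_sym.
have good_a d : copies_of_K a d -> ~~ e (f' a) (f' d).
  move=> /andP[/eqP ad1 ad2]; rewrite !ffunE tpermL tpermD.
  - by rewrite sym_e ne_b // ad1.
  - by apply: contraNneq ad2 => ->.
  - by apply: contraNneq ab => ->; rewrite ad1.
have good_b d : copies_of_K b d -> ~~ e (f' b) (f' d).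
  move=> /andP[/eqP bd1 bd2]; rewrite !ffunE tpermR tpermD.
  - by rewrite ne_a // bd1.
  - by apply: contraNneq ab => ->; rewrite bd1.
  - by apply: contraNneq bd2 => ->.
have copies_sym (c d : X) : copies_of_K c d -> copies_of_K d c.
  by rewrite /copies_of_K eq_sym [d.2 == _]eq_sym.
apply/properP; split; last first.
  exists (a, a'); rewrite inE /= aa' ?eaa' //=; exact: good_a.
apply/subsetP => -[c d]; rewrite !inE /= => /andP[cd ecd]; rewrite cd /=.
have ac : a != c by apply: contraTneq ecd => ac; rewrite -ac good_a // ac.
have bc : b != c by apply: contraTneq ecd => bc; rewrite -bc good_b // bc.
have dc := copies_sym _ _ cd.
have ad : a != d.
  by apply: contraTneq ecd => ad; rewrite sym_e -ad good_a // ad.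
have bd : b != d.
  by apply: contraTneq ecd => bd; rewrite sym_e -bd good_b // bd.
by move: ecd; rewrite !ffunE !tpermD.
Qed.

(** The vertices of [B] are covered one by one, each with [r] low-degree vertices. [U] collects what
    must be avoided: it grows by [r.+1] whenever [B] loses a vertex, so [#|U| + r.+1 * #|B|] stays
    constant. *)
Lemma tiled_greedy (T r : nat) (L : {set V}) :
    {in L, forall v, degree v <= T} ->
  forall B U : {set V}, [disjoint B & U] ->
    {in B, forall b, #|U| + r.+1 * #|B| + r * T.+1 <=
                     #|[set w in L | ~~ e b w]|} ->
  exists W, [/\ tiled r.+1 W, B \subset W, [disjoint W & U]
    & #|W| <= r.+1 * #|B|].
Proof.
move=> degL B; have [m cB] : exists m, #|B| = m by exists #|B|.
elim: m B cB => [|m IHm] B cB U dBU room.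
  exists set0; rewrite cards0 (cards0_eq cB) sub0set disjoints_subset sub0set.
  split=> //; exists 0, (fun p : 'I_0 * 'I_r.+1 => False_rect V (notF (ltn_ord p.1))).
  by split=> [[[]]|| [[]]] //; apply/setP => x; rewrite inE; apply/imsetP => -[[[]]].
have /set0Pn[b bB] : B != set0 by rewrite -card_gt0 cB.
(* Excluding all of [B] keeps its other vertices free for blocks of their own. *)
pose C := [set w in L | ~~ e b w] :\: (U :|: B).
have [||I [IC cI indI]] := @independent_subset T r C.
- by move=> w; rewrite !inE => /and3P[_ /degL].
- have := room b bB; have := cardsID (U :|: B) [set w in L | ~~ e b w].
  have := subset_leq_card (subsetIr [set w in L | ~~ e b w] (U :|: B)).
  have := (leq_card_setU U B).1; rewrite -/C; nia.
have IP w : w \in I -> [/\ ~~ e b w, w \notin U & w \notin B].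
  by move=> /(subsetP IC); rewrite !inE negb_or => /andP[/andP[? ?] /andP[_ ?]].
have bI : b \notin I by apply/negP => /IP[_ _]; rewrite bB.
have indP : independent (b |: I).
  move=> x y; rewrite !inE => /orP[/eqP->|xI] /orP[/eqP->|yI].
  - by rewrite irr_e.
  - by have [] := IP y yI.
  - by rewrite sym_e; have [] := IP x xI.
  - exact: indI.
have cP : #|b |: I| = r.+1 by rewrite cardsU1 bI cI.
have cB' : #|B :\ b| = m by have := cardsD1 b B; rewrite bB cB => -[].
have [||W [tW BW dW cW]] := IHm (B :\ b) cB' (U :|: (b |: I)).
- rewrite disjoints_subset; apply/subsetP => x /setD1P[xb xB].
  rewrite !inE (negPf xb) /= (disjointFr dBU xB) /=.
  by apply/negP => /IP[_ _]; rewrite xB.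
- move=> x /setD1P[_ xB]; have := room x xB.
  by have := (leq_card_setU U (b |: I)).1; rewrite cP cB cB'; nia.
have dWU : [disjoint W & U].
  by apply: disjointWr dW; exact: subsetUl.
have dPW : [disjoint b |: I & W].
  by rewrite disjoint_sym; apply: disjointWr dW; exact: subsetUr.
exists ((b |: I) :|: W); split.
- by apply: tiledU => //; rewrite -cP; exact: tiled_independent.
- apply/subsetP => x xB; rewrite !inE; have [//|xb] := eqVneq x b.
  by rewrite (subsetP BW) ?orbT // !inE xb.
- rewrite disjoints_subset subUset -!disjoints_subset dWU andbT.
  rewrite disjoints_subset subUset sub1set inE (disjointFr dBU bB) /=.
  by apply/subsetP => x /IP[]; rewrite inE.
- by rewrite cB; have := (leq_card_setU (b |: I) W).1; rewrite cP cB' in cW *; lia.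
Qed.

(** Markov's inequality for the degrees. *)
Lemma card_high_degree T :
  #|~: [set v | degree v <= T]| * T <= \sum_v degree v.
Proof.
rewrite -sum_nat_const [leqRHS](bigID (mem (~: [set v | degree v <= T]))) /=.
apply: leq_trans (leq_addr _ _).
by apply: leq_sum => v; rewrite !inE -ltnNge => /ltnW.
Qed.

(* The first block covers a vertex of maximum degree, so that by [deg_pair] all
   remaining degrees are at most half of [#|V|]. *)
Lemma tiling_of_few_edges (r : nat) :
    0 < r -> r.+1 %| #|V| -> 200 * (r.+1 * r.+1) <= #|V| ->
    \sum_v degree v <= 2 * #|V| ->
    (forall v w, v != w -> degree v + degree w <= #|V|) ->
    (forall v, exists I : {set V}, [/\ #|I| = r, independent I, v \notin I
      & {in I, forall w, ~~ e v w}]) ->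
  tiled r.+1 setT.
Proof.
move=> r0 dvd_n big sum_deg deg_pair nbh.
set n := #|V| in dvd_n big sum_deg deg_pair *; pose s := r.+1.
(* With total degree at most [2 * n], this threshold leaves at most [n / (16 * s)] vertices outside
   [L]. *)
pose T := 32 * s; pose L := [set v | degree v <= T].
pose h := #|~: L|.
have degL : {in L, forall v, degree v <= T} by move=> v; rewrite inE.
have hn : 16 * (s * h) <= n.
  suff : h * T <= 2 * n by rewrite /T; nia.
  exact: leq_trans (card_high_degree T) sum_deg.
have cL : n <= #|L| + h by rewrite /h cardsC.
have /card_gt0P[x0 _] : 0 < #|V| by rewrite -/n; lia.
have [v maxv] : exists v, forall w, degree w <= degree v.
  have [v _ vm] := @arg_maxnP _ x0 predT degree erefl.
  by exists v => w; exact: vm.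
have [I [cI indI vI nvI]] := nbh v.
have indP : independent (v |: I).
  move=> x y; rewrite !inE => /orP[/eqP->|xI] /orP[/eqP->|yI].
  - by rewrite irr_e.
  - exact: nvI.
  - by rewrite sym_e nvI.
  - exact: indI.
have cP : #|v |: I| = s by rewrite cardsU1 vI cI.
have tP : tiled s (v |: I) by rewrite -cP; exact: tiled_independent.
have [|b|W [tW BW dW cW]] := @tiled_greedy T r L degL (~: L :\: (v |: I)) (v |: I).
- by rewrite disjoints_subset; apply/subsetP => x /setDP[_ xP]; rewrite in_setC.
- rewrite cP -/s => /setDP[bL]; rewrite in_setU1 negb_or => /andP[bv _].
  (* The degrees of [b] and of the maximal vertex [v] add up to at most [n], so the smaller one is
     at most half of [n]. *)
  have db : 2 * degree b <= n.
    by have := deg_pair b v bv; have := maxv b; lia.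
  have cB : #|~: L :\: (v |: I)| <= h by apply: subset_leq_card; exact: subsetDl.
  have : #|L| <= #|[set w in L | ~~ e b w]| + degree b.
    apply: leq_trans (leq_card_setU _ _).1; apply: subset_leq_card.
    by apply/subsetP => w wL; rewrite !inE in wL *; rewrite wL; case: (e b w).
  have : s * #|~: L :\: (v |: I)| <= s * h by rewrite leq_mul2l cB orbT.
  have : r * T.+1 <= s * s * 33 by rewrite /T /s; nia.
  have : s <= s * s by rewrite /s; nia.
  have : h <= s * h by rewrite /s; nia.
  by rewrite -/s in big; lia.
have tPW : tiled s ((v |: I) :|: W) by apply: tiledU => //; rewrite disjoint_sym.
set Q := (v |: I) :|: W in tPW.
have cQ : #|Q| <= s + s * h.
  apply: leq_trans (leq_card_setU _ _).1 _; rewrite cP leq_add2l.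
  apply: leq_trans cW _; rewrite leq_mul2l; apply/orP; right.
  by apply: subset_leq_card; exact: subsetDl.
have cQC : #|Q| + #|~: Q| = n by rewrite cardsC.
have /dvdnP[k ck] : s %| #|~: Q|.
  by have := tiled_card tPW; rewrite -/s -cQC in dvd_n *; move/dvdn_addr <-.
have tR : tiled s (~: Q).
  (* Every vertex of high degree lies in the first block or in [W], so only low degrees remain. *)
  apply: (@tiled_low_degree T k) => //.
    move=> x; rewrite in_setC in_setU negb_or => /andP[xP xW].
    by apply: contraNT xW => xT; apply: (subsetP BW); rewrite !inE in xP *; rewrite xP xT.
  have : s <= s * s by rewrite /s; nia.
  by rewrite /T -/s in big *; nia.
have -> : [set: V] = Q :|: ~: Q by rewrite setUCr.
by apply: tiledU => //; rewrite disjoints_subset setCK.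
Qed.

End Tilings.

Local Open Scope ring_scope.

(** * Graphs with a large eigenvalue *)

(** Every edge has at most one end among [v] and [w], except [vw] itself, for which the last term
    corrects. *)
Lemma degree_pair (V : finType) (e : rel V) v w : symmetric e -> irreflexive e -> v != w ->
  (2 * (degree e v + degree e w) <= \sum_u degree e u + 2 * e v w)%N.
Proof.
move=> sym_e irr_e vw; rewrite (bigD1 v) //= (bigD1 w) 1?eq_sym //=.
have degE z : degree e z = (\sum_u e u z)%N.
  rewrite /degree -sum1_card big_mkcond; apply: eq_bigr => u _.
  by rewrite inE sym_e; case: (e u z).
have rest z : degree e z = (e v z + (e w z + \sum_(u | (u != v) && (u != w)) e u z))%N.
  by rewrite degE (bigD1 v) //= (bigD1 w) 1?eq_sym.
suff : (\sum_(u | (u != v) && (u != w)) (e u v + e u w) <=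
        \sum_(u | (u != v) && (u != w)) degree e u)%N.
  rewrite big_split /=; have := rest v; have := rest w.
  by rewrite !(sym_e _ w) !irr_e; lia.
apply: leq_sum => u _; rewrite /degree (cardD1 v) (cardD1 w) !inE eq_sym vw /=.
by rewrite addnA leq_addr.
Qed.

Lemma sum_adj_mx (R : realType) n (G : rel 'I_n) (x : 'I_n -> R) i :
  \sum_j adj_mx R G i j * x j = \sum_(j | G i j) x j.
Proof.
rewrite [RHS]big_mkcond; apply: eq_bigr => j _; rewrite mxE.
by case: (G i j); rewrite ?mul1r ?mul0r.
Qed.

Lemma adj_mx_sym (R : realType) n (G : rel 'I_n) :
  symmetric G -> (adj_mx R G)^T = adj_mx R G.
Proof. by move=> symG; apply/matrixP => i j; rewrite !mxE symG. Qed.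

Lemma lambda_perron (R : realType) n (G : rel 'I_n.+1) : symmetric G ->
  (forall y, qform (adj_mx R G) y <= lambda R G * sqnorm y) /\
  exists x : 'I_n.+1 -> R, [/\ forall i, 0 <= x i <= 1, exists i, x i = 1
    & forall i, \sum_(j | G i j) x j = lambda R G * x i].
Proof.
move=> symG; have [|bound [x [x01 x1 eigx]]] := lambda_max_perron (adj_mx_sym R symG).
  by move=> i j; rewrite mxE ler0n.
by split=> //; exists x; split=> // i; rewrite -sum_adj_mx eigx.
Qed.

Lemma lambda_iso (R : realType) n (G H : rel 'I_n.+1) :
  symmetric H -> graph_iso G H -> lambda R G = lambda R H.
Proof.
move=> symH [s sGH].
have symG : symmetric G by move=> i j; rewrite !sGH symH.
have [bound [x [_ [i xi] eigx]]] := lambda_perron R symH.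
apply: (@lambda_maxE _ _ _ _ (x \o s) ((s^-1)%g i)); first exact: adj_mx_sym.
- move=> y; have -> : sqnorm y = sqnorm (y \o s^-1%g).
    by rewrite /sqnorm (reindex_inj (@perm_inj _ s^-1%g)).
  suff -> : qform (adj_mx R G) y = qform (adj_mx R H) (y \o s^-1%g) by [].
  rewrite /qform (reindex_inj (@perm_inj _ s^-1%g)); apply: eq_bigr => k _.
  rewrite !sum_adj_mx /=; congr (_ * _).
  rewrite [LHS](reindex_inj (@perm_inj _ s^-1%g)) /=.
  by apply: eq_bigl => j; rewrite sGH !permKV.
- move=> k; rewrite sum_adj_mx /= -eigx [RHS](reindex_inj (@perm_inj _ s)).
  by apply: eq_bigl => j; rewrite sGH.
- by rewrite /= permKV xi oner_neq0.
Qed.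

(** The Rayleigh bound is tested on the indicator vector of [W]. *)
Lemma lambda_clique (R : realType) n (G : rel 'I_n.+1) (W : {set 'I_n.+1}) m :
    symmetric G -> #|W| = m.+1 -> {in W &, forall i j, i != j -> G i j} ->
  m%:R <= lambda R G.
Proof.
move=> symG cW clW; have [bound _] := lambda_perron R symG.
pose y i : R := (i \in W)%:R.
have sy : sqnorm y = m.+1%:R.
  rewrite -cW -sum1_card natr_sum [RHS]big_mkcond /=; apply: eq_bigr => i _.
  by rewrite /y; case: (i \in W); rewrite ?expr1n ?expr0n.
have qy : m%:R * m.+1%:R <= qform (adj_mx R G) y.
  rewrite /qform -[in X in X <= _]cW -sum1_card natr_sum mulr_sumr big_mkcond /=.
  apply: ler_sum => i _; rewrite sum_adj_mx /y.
  case: ifPn => iW; last by rewrite mul0r.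
  rewrite mul1r mulr1 -(_ : #|W :\ i| = m); last first.
    by have := cardsD1 i W; rewrite iW cW => -[].
  rewrite -sum1_card natr_sum big_mkcond [leRHS]big_mkcond /=.
  apply: ler_sum => j _; rewrite !inE; case: eqVneq => [->|ji] /=.
    by case: ifP => // _; rewrite ler0n.
  case: ifPn => jW; last by case: ifP.
  by rewrite clW // eq_sym.
by have := le_trans qy (bound y); rewrite sy ler_pM2r // ltr0n.
Qed.

Definition compl_rel (V : eqType) (G : rel V) : rel V :=
  fun i j => (i != j) && ~~ G i j.

Lemma compl_rel_sym (V : eqType) (G : rel V) : symmetric G -> symmetric (compl_rel G).
Proof. by move=> symG i j; rewrite /compl_rel eq_sym symG. Qed.

Lemma compl_rel_irr (V : eqType) (G : rel V) : irreflexive (compl_rel G).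
Proof. by move=> i; rewrite /compl_rel eqxx. Qed.

Section LargeEigenvalue.
Variables (R : realType) (n : nat) (G : rel 'I_n.+1) (lam : R) (x : 'I_n.+1 -> R).
Hypotheses (simpleG : simple_graph G) (n_gt0 : (0 < n)%N).
Hypothesis x01 : forall i, 0 <= x i <= 1.
Variable top : 'I_n.+1.
Hypothesis xtop : x top = 1.
Hypothesis eigx : forall i, \sum_(j | G i j) x j = lam * x i.
Hypothesis lam_large : n%:R - 1 <= lam.

Let D := compl_rel G.
Let S := \sum_j x j.

Lemma sum_by_adjacency v (y : 'I_n.+1 -> R) :
  \sum_j y j = y v + \sum_(j | G v j) y j + \sum_(j | D v j) y j.
Proof.
rewrite (bigD1 v) //= -addrA; congr (_ + _); rewrite (bigID (G v)) /=.
congr (_ + _); apply: eq_bigl => j; last by rewrite /D /compl_rel eq_sym.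
by case: eqVneq => [->|//]; rewrite simpleG.2.
Qed.

Lemma compl_eigen v : (lam + 1) * x v = S - \sum_(j | D v j) x j.
Proof. by rewrite /S (sum_by_adjacency v) eigx; ring. Qed.

Lemma perron_sum_ge : lam + 1 <= S.
Proof.
have := compl_eigen top; rewrite xtop mulr1 => ->; rewrite lerBlDr lerDl.
by apply: sumr_ge0 => j _; have /andP[] := x01 j.
Qed.

(** There are [n.+1] vertices, while [perron_sum_ge] and [lam_large] give [S >= n]. *)
Lemma perron_sum_deficit : \sum_j (1 - x j) <= 1.
Proof.
rewrite sumrB sumr_const card_ord -/S -natr1.
by have := perron_sum_ge; have := lam_large; lra.
Qed.

Lemma perron_sum_le : S <= n.+1%:R.
Proof.
rewrite -[n.+1 in leRHS]card_ord -sumr_const; apply: ler_sum => j _.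
by have /andP[] := x01 j.
Qed.

(** The gap between the degree and the sum is part of the total deficit, which is at most 1. *)
Lemma sum_nbh_bounds v :
  (degree D v)%:R - 1 <= \sum_(j | D v j) x j <= (degree D v)%:R.
Proof.
have degE : (degree D v)%:R = \sum_(j | D v j) (1 : R).
  by rewrite sumr_const /degree cardsE.
apply/andP; split; last first.
  by rewrite degE; apply: ler_sum => j _; have /andP[] := x01 j.
rewrite degE lerBlDr -lerBlDl -sumrB; apply: le_trans perron_sum_deficit.
rewrite [leRHS](bigID (D v)) /= lerDl; apply: sumr_ge0 => j _.
by rewrite subr_ge0; have /andP[] := x01 j.
Qed.

(** Together with [eigen_upper] this determines [(lam + 1) * x v] from the degree in [D] up to a
    bounded error, which allows two entries to be compared. *)
Lemma eigen_lower v : n%:R - (degree D v)%:R <= (lam + 1) * x v.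
Proof.
have := compl_eigen v; have := perron_sum_ge; have := lam_large; have /andP[] := sum_nbh_bounds v.
by lra.
Qed.

Lemma eigen_upper v : (lam + 1) * x v <= n.+1%:R - (degree D v)%:R + 1.
Proof.
have := compl_eigen v; have := perron_sum_le; have /andP[] := sum_nbh_bounds v.
by lra.
Qed.

(** Summing [compl_eigen] over all vertices evaluates the degrees weighted by [x v]; the remaining
    weights [1 - x v] are controlled by the total deficit. *)
Lemma sum_degree_compl : (\sum_v degree D v <= 2 * n)%N.
Proof.
rewrite -(ler_nat R) natr_sum.
have sumdx : \sum_v (degree D v)%:R * x v = (n%:R - lam) * S.
  have dbl : \sum_v \sum_(j | D v j) x j = \sum_v (degree D v)%:R * x v.
    rewrite (exchange_big_dep xpredT) //=; apply: eq_bigr => j _.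
    rewrite sumr_const mulr_natl /degree cardsE; congr (_ *+ _).
    by apply: eq_card => i; apply: compl_rel_sym; exact: simpleG.1.
  have : \sum_v (lam + 1) * x v = \sum_v (S - \sum_(j | D v j) x j).
    by apply: eq_bigr => v _; exact: compl_eigen.
  rewrite -mulr_sumr sumrB sumr_const card_ord -/S dbl -[S *+ _]mulr_natl -natr1.
  by lra.
have sumd1 : \sum_v (degree D v)%:R * (1 - x v) <= n%:R * (n.+1%:R - S).
  have -> : n.+1%:R - S = \sum_v (1 - x v) by rewrite sumrB sumr_const card_ord.
  rewrite mulr_sumr; apply: ler_sum => v _; apply: ler_wpM2r.
    by rewrite subr_ge0; have /andP[] := x01 v.
  rewrite ler_nat; have : (degree D v < #|'I_n.+1|)%N.
    rewrite -cardsT; apply: proper_card; rewrite properT.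
    by apply/eqP => /setP/(_ v); rewrite !inE /D compl_rel_irr.
  by rewrite card_ord ltnS.
have -> : \sum_v (degree D v)%:R =
    \sum_v (degree D v)%:R * x v + \sum_v (degree D v)%:R * (1 - x v).
  by rewrite -big_split; apply: eq_bigr => v _ /=; ring.
(* The two parts add up to at most [n * n.+1 - lam * S], and [lam * S >= (n - 1) * n]. *)
have := perron_sum_ge; have := lam_large; have : 1 <= n%:R :> R by rewrite ler1n.
by move: sumdx sumd1; rewrite natrM -natr1; nra.
Qed.

End LargeEigenvalue.

(** * Comparison with the extremal graph *)

Lemma subset_interpolate (V : finType) (A B : {set V}) m :
    A \subset B -> (#|A| <= m <= #|B|)%N ->
  exists C : {set V}, [/\ A \subset C, C \subset B & #|C| = m].
Proof.
move=> AB /andP[Am mB]; rewrite -(subnKC Am) in mB *.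
elim: (m - #|A|)%N mB => [|k IHk] mB; first by exists A; rewrite addn0.
have [|C [AC CB cC]] := IHk; first lia.
have [w wB wC] : exists2 w, w \in B & w \notin C.
  apply/subsetPn/negP => BC; have := subset_leq_card BC; lia.
exists (w |: C); split.
- exact: subset_trans AC (subsetUr _ _).
- by rewrite subUset sub1set wB.
- by rewrite cardsU1 wC cC; lia.
Qed.

(** [H_adj] freed from its labelling: [v] takes the place of the vertex outside the clique, and [M]
    that of its neighbourhood. *)
Definition pendant (V : finType) (v : V) (M : {set V}) : rel V := fun i j =>
  (i != j) && (if i == v then j \in M else if j == v then i \in M else true).

Lemma pendant_sym (V : finType) (v : V) M : symmetric (pendant v M).
Proof.
move=> i j; rewrite /pendant eq_sym.
by case: (eqVneq i v) => [->|]; case: (eqVneq j v) => [->|]; rewrite ?eqxx.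
Qed.

(** The vertices are listed as [M], then the rest, then [v]; the position in the list is the
    isomorphism. *)
Lemma pendant_iso n r (v : 'I_n.+1) (M : {set 'I_n.+1}) :
  v \notin M -> #|M| = r.-1 -> graph_iso (pendant v M) (@H_adj n.+1 r).
Proof.
move=> vM cM; pose rest := ~: (v |: M).
pose l := enum M ++ enum rest ++ [:: v].
have all_l i : i \in l.
  by rewrite !mem_cat !mem_enum !inE; case: (i == v); case: (i \in M).
have sl : size l = n.+1.
  rewrite !size_cat -!cardE /=; have := cardsC (v |: M).
  by rewrite cardsU1 vM card_ord -/rest; apply: etrans; rewrite addnA addn1 add1n addSn.
have lt_l i : (index i l < n.+1)%N by have := all_l i; rewrite -index_mem sl.
have inj_l : injective (fun i => Ordinal (lt_l i)).
  move=> i j [/(congr1 (nth v l))]; rewrite !nth_index //.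
have idxM i : (index i l < r.-1)%N = (i \in M).
  rewrite /l index_cat mem_enum -cM cardE; case: ifP => iM.
    by rewrite index_mem mem_enum iM.
  by rewrite ltnNge leq_addr.
have idxv i : (index i l == n) = (i == v).
  have lv : index v l = n.
    have vr : v \notin rest by rewrite !inE eqxx.
    rewrite /l !index_cat !mem_enum (negPf vM) (negPf vr) /= eqxx addn0.
    by move: sl; rewrite !size_cat /= addn1 addnS => -[].
  apply/eqP/eqP => [iv|->//]; apply: inj_l; apply: val_inj => /=.
  by rewrite iv lv.
exists (perm inj_l) => i j; rewrite /pendant /H_adj !permE (inj_eq inj_l) /=.
by rewrite !idxv !idxM.
Qed.

(** [M] is largest among the independent subsets of [N] with fewer than [r] elements. Adding a
    further vertex would give size at most [r], and size [r] is excluded. *)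
Lemma maximal_independent (V : finType) (e : rel V) (N : {set V}) r :
    symmetric e -> irreflexive e -> (0 < r)%N ->
    (forall I : {set V}, I \subset N -> independent e I -> #|I| <> r) ->
  exists M : {set V}, [/\ M \subset N, (#|M| <= r.-1)%N
    & forall i, i \in N -> i \notin M -> exists2 w, w \in M & e i w].
Proof.
move=> sym_e irr_e r0 noI.
pose P (I : {set V}) := [&& I \subset N, (#|I| < r)%N &
  [forall i in I, forall j in I, ~~ e i j]].
have P0 : P set0.
  by rewrite /P sub0set cards0 r0; apply/forall_inP => i; rewrite inE.
have [M /and3P[MN cM /forall_inP indM] Mmax] := arg_maxnP (fun I : {set V} => #|I|) P0.
exists M; split=> // [|i iN iM]; first lia.
apply/exists_inP; apply: contraT; rewrite negb_exists_in => /forall_inP nie.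
have indU : {in i |: M &, forall a b, ~~ e a b}.
  move=> a b; rewrite !inE => /orP[/eqP->|aM] /orP[/eqP->|bM].
  - by rewrite irr_e.
  - exact: nie.
  - by rewrite sym_e nie.
  - exact: (forall_inP (indM a aM)).
have UN : i |: M \subset N by rewrite subUset sub1set iN.
have cU : #|i |: M| = #|M|.+1 by rewrite cardsU1 iM.
have := noI _ UN indU; rewrite cU => neq.
have /Mmax /= : P (i |: M); last by rewrite cU ltnn.
apply/and3P; split=> //; first lia.
by apply/forall_inP => a aU; apply/forall_inP => b bU; exact: indU.
Qed.

(* The copy of [H_{n,r}] is compared with [G] through the form at [x]: each
   edge [v i] that is lost corresponds to a gained edge [i w], [w] in [M], and
   the factor 2 in [2 * x v < x w] avoids a double count of the gained edges. *)
Lemma lambda_pendant (R : realType) n r (G : rel 'I_n.+1) (x : 'I_n.+1 -> R) v :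
    simple_graph G -> (0 < r)%N -> (r <= n.+1)%N ->
    (forall i, 0 <= x i) -> (forall i, i != v -> 2 * x v < x i) ->
    (forall i, \sum_(j | G i j) x j = lambda R G * x i) -> 0 < sqnorm x ->
    (forall I : {set 'I_n.+1}, I \subset [set w | G v w] ->
       independent (compl_rel G) I -> #|I| <> r) ->
  exists M : {set 'I_n.+1}, [/\ v \notin M, #|M| = r.-1,
     lambda R G <= lambda R (pendant v M)
   & lambda R G = lambda R (pendant v M) -> G =2 pendant v M].
Proof.
move=> [symG irrG] r0 rn x0 xv eigx sx noI.
pose D := compl_rel G.
have symD : symmetric D by exact: compl_rel_sym.
have [M0 [M0N cM0 M0max]] := maximal_independent symD (@compl_rel_irr _ G) r0 noI.
have vM0 : v \notin M0.
  by apply/negP => /(subsetP M0N); rewrite inE irrG.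
(* [M0] may have fewer than [r.-1] vertices; padding it yields the size that [H_adj] requires. *)
have [||M [M0M Mv cM]] := @subset_interpolate _ M0 (~: [set v]) r.-1.
- by apply/subsetP => i iM; rewrite !inE; apply: contraNneq vM0 => <-.
- by rewrite cM0 cardsC1 card_ord; lia.
have vM : v \notin M by apply/negP => /(subsetP Mv); rewrite !inE eqxx.
set K := pendant v M.
have symK : symmetric K by exact: pendant_sym.
have [bound _] := lambda_perron R symK.
have xp i : i != v -> 0 < x i by move=> /xv; have := x0 v; lra.
(* At [i], [c i] is the weight gained by completing the clique and [d i] the change in the edge to
   [v]. That edge is seen from both ends, hence the factor 2 in [t]. *)
pose c i := \sum_(j | (j != v) && D i j) x j.
have c0 i : 0 <= c i by apply: sumr_ge0 => j _; exact: x0.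
pose d i : R := (i \in M)%:R - (G v i)%:R.
pose t i := c i + 2 * d i * x v.
have boolsum (Q : pred 'I_n.+1) : \sum_(j | Q j) x j = \sum_j (Q j)%:R * x j.
  by rewrite big_mkcond; apply: eq_bigr => j _; case: (Q j); rewrite ?mul1r ?mul0r.
have rowK i : i != v ->
    \sum_(j | K i j) x j = lambda R G * x i + c i + d i * x v.
  move=> iv; have -> : d i * x v = \sum_j (j == v)%:R * (d i * x j).
    rewrite (bigD1 v) //= eqxx mul1r big1 ?addr0 // => j /negPf ->.
    by rewrite mul0r.
  rewrite -eigx /c !boolsum -!big_split; apply: eq_bigr => j _ /=.
  rewrite -mulrDl mulrA -mulrDl; congr (_ * _).
  rewrite /K /pendant /D /compl_rel /d (negPf iv).
  case: (eqVneq j v) => [->|jv] /=; first by rewrite iv symG /=; ring.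
  by case: (eqVneq i j) => [->|ij] /=; rewrite ?irrG; case: (G i j) => /=; ring.
have rowv : \sum_(j | K v j) x j = \sum_(j in M) x j.
  apply: eq_bigl => j; rewrite /K /pendant eqxx.
  by case: eqVneq => [<-|//]; rewrite (negPf vM).
have sumd : \sum_(j in M) x j - lambda R G * x v = \sum_(i | i != v) d i * x i.
  have -> : \sum_(i | i != v) d i * x i = \sum_i d i * x i.
    by rewrite [RHS](bigD1 v) //= /d (negPf vM) irrG subrr mul0r add0r.
  rewrite -eigx !boolsum -sumrB; apply: eq_bigr => j _.
  by rewrite /d; ring.
have qK : qform (adj_mx R K) x =
    lambda R G * sqnorm x + \sum_(i | i != v) x i * t i.
  rewrite /qform (bigD1 v) //= sum_adj_mx rowv.
  have -> : \sum_(j in M) x j = lambda R G * x v + \sum_(i | i != v) d i * x i.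
    by rewrite -sumd; ring.
  rewrite /sqnorm [in RHS](bigD1 v) //= !mulrDr !mulr_sumr -addrA -big_split /=.
  rewrite -addrA -big_split /=; congr (_ + _); first by ring.
  by apply: eq_bigr => i iv; rewrite sum_adj_mx rowK // /t; ring.
(* For a lost edge [v i], maximality gives [w] in [M0] not adjacent to [i], so
   [c i >= x w > 2 * x v]. *)
have t_gt0 i : G v i -> i \notin M -> 0 < t i.
  move=> Gvi iM; have iv : i != v by apply: contraTneq Gvi => ->; rewrite irrG.
  have [||w wM Diw] := M0max i; first by rewrite inE.
    by apply: contraNN iM => /(subsetP M0M).
  have wv : w != v by apply: contraNneq vM0 => <-.
  have : x w <= c i.
    rewrite /c (bigD1 w) ?wv //= lerDl; apply: sumr_ge0 => j _; exact: x0.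
  by rewrite /t /d (negPf iM) Gvi /=; have := xv w wv; lra.
have t_ge0 i : i != v -> 0 <= t i.
  move=> iv; have [/andP[Gvi iM]|iM] := boolP ((G v i) && (i \notin M)).
    exact/ltW/t_gt0.
  have d0 : 0 <= d i.
    by move: iM; rewrite /d; case: (G v i); case: (i \in M); rewrite //= ?subrr ?subr0.
  by rewrite /t; have := c0 i; have := x0 v; nra.
have sum_t0 : 0 <= \sum_(i | i != v) x i * t i.
  by apply: sumr_ge0 => i iv; rewrite mulr_ge0 ?t_ge0.
exists M; rewrite -/K; split=> //.
  by rewrite -(ler_pM2r sx); have := bound x; rewrite qK; lra.
move=> eq_lam.
(* Equality makes every [t i] vanish; then no edge at [v] is lost, so [d] is nonnegative and each
   [c i] is 0 as well. *)
have sum0 : \sum_(i | i != v) x i * t i = 0.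
  by have := bound x; rewrite qK -eq_lam; lra.
have t0 i : i != v -> t i = 0.
  move=> iv; have xt0 k : k != v -> 0 <= x k * t k.
    by move=> kv; rewrite mulr_ge0 ?t_ge0.
  by have /eqP := psumr_eq0P xt0 sum0 iv; rewrite mulf_eq0 gt_eqF ?xp //= => /eqP.
have subM i : G v i -> i \in M.
  move=> Gvi; apply: contraT => /(t_gt0 i Gvi).
  rewrite t0 ?ltxx //; by apply: contraTneq Gvi => ->; rewrite irrG.
have d0 i : 0 <= d i.
  rewrite /d subr_ge0 ler_nat; case: (boolP (G v i)) => // /subM ->.
  by [].
have ci0 i : i != v -> c i = 0.
  move=> iv; have := t0 i iv; rewrite /t.
  by have := c0 i; have := x0 v; have := d0 i; nra.
(* As [x v] may be 0, [t i = 0] does not give [d i = 0]. But [x] attains the maximum for [K], hence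
   is an eigenvector, and its equation at [v] makes the sum of the [d i * x i] vanish. *)
have eigK : qform (adj_mx R K) x = lambda R K * sqnorm x.
  by rewrite qK sum0 addr0 eq_lam.
have Mrow : \sum_(j in M) x j = \sum_(j | G v j) x j.
  rewrite -rowv -sum_adj_mx.
  by rewrite (rayleigh_eq_eigen (adj_mx_sym R symK) bound eigK) -eq_lam eigx.
have dsum0 : \sum_(i | i != v) d i * x i = 0 by rewrite -sumd Mrow eigx subrr.
have di0 i : i != v -> (i \in M) = G v i.
  move=> iv; have dx0 k : k != v -> 0 <= d k * x k by rewrite mulr_ge0.
  have /eqP := psumr_eq0P dx0 dsum0 iv; rewrite mulf_eq0 (gt_eqF (xp i iv)) orbF.
  by rewrite /d subr_eq0 eqr_nat; case: (i \in M); case: (G v i).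
have Grow j : G v j = K v j.
  rewrite /K /pendant eqxx; case: eqVneq => [<-|vj] /=; first by rewrite irrG.
  by rewrite di0 // eq_sym.
move=> i j; have [->//|iv] := eqVneq i v.
have [->|jv] := eqVneq j v; first by rewrite symG symK.
rewrite /K /pendant (negPf iv) (negPf jv).
have [->|ij] /= := eqVneq i j; first by rewrite irrG.
(* A missing edge [ij] away from [v] would put the positive entry [x j] into [c i]. *)
apply/negPn/negP => nG; have xj k : (k != v) && D i k -> 0 <= x k by [].
have Dij : (j != v) && D i j by rewrite jv /D /compl_rel ij nG.
by have := xp j jv; rewrite (psumr_eq0P xj (ci0 i iv) Dij) ltxx.
Qed.

(** * Eigenvalue of the extremal graph, and neighbourhoods without an [r]-clique *)

Lemma H_adj_sym n m : symmetric (@H_adj n m).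
Proof.
move=> i j; rewrite /H_adj eq_sym.
case: (eqVneq (i : nat) n.-1) => [iE|]; case: (eqVneq (j : nat) n.-1) => [jE|] //.
by have -> : i = j; [apply: val_inj; rewrite /= iE jE | rewrite eqxx].
Qed.

(** The vertices other than the last form a clique on [n] vertices. *)
Lemma lambda_H_lower (R : realType) n r :
  (0 < n)%N -> n%:R - 1 <= lambda R (@H_adj n.+1 r).
Proof.
case: n => // n _; rewrite -natr1 addrK.
apply: (@lambda_clique _ _ _ (~: [set ord_max])); first exact: H_adj_sym.
  by rewrite cardsC1 card_ord.
move=> i j; rewrite !inE -!val_eqE /H_adj /= => /negPf -> /negPf -> ij.
by rewrite -val_eqE /= ij.
Qed.

Lemma tiled_contains (V : finType) (G : rel V) s : (0 < s)%N ->
    tiled (compl_rel G) s setT ->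
  contains_subgraph (@copies_of_K (#|V| %/ s) s) G.
Proof.
move=> s0 [k [f [injf imf ef]]].
have <- : k = (#|V| %/ s)%N.
  by rewrite -cardsT -imf card_imset // cardsT card_prod !card_ord mulnK.
exists f; split=> // u v uv; have := ef u v uv.
rewrite /compl_rel (inj_eq injf) negb_and negbK negbK.
by case/orP => // /eqP uv_eq; move: uv; rewrite uv_eq /copies_of_K !eqxx.
Qed.

Lemma degree_compl n (G : rel 'I_n.+1) v : irreflexive G ->
  (#|[set w | G v w]| + degree (compl_rel G) v)%N = n.
Proof.
move=> irrG; have := cardsC [set w | G v w].
have -> : ~: [set w | G v w] = v |: [set w | compl_rel G v w].
  apply/setP => w; rewrite !inE /compl_rel eq_sym.
  by case: eqVneq => [->|//]; rewrite irrG.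
by rewrite cardsU1 inE compl_rel_irr card_ord /degree /= add1n addnS => -[].
Qed.

(** The neighbourhood has fewer than [r * T.+1] low-degree vertices, since otherwise a greedy choice
    yields an [r]-clique, and high-degree vertices are few by Markov. The constants 3 and 5 are
    those needed to compare [x v] with the other entries. *)
Lemma card_nbh_le n (G : rel 'I_n.+1) r v : simple_graph G ->
    (200 * (r.+1 * r.+1) <= n.+1)%N ->
    (\sum_w degree (compl_rel G) w <= 2 * n)%N ->
    (forall I : {set 'I_n.+1}, I \subset [set w | G v w] ->
       independent (compl_rel G) I -> #|I| <> r) ->
  (3 * #|[set w | G v w]| + 5 < n)%N.
Proof.
move=> [symG irrG] big sum_deg noI; set D := compl_rel G in sum_deg noI.
set N := [set w | G v w] in noI *.
pose T := (32 * r.+1)%N; pose L := [set w | (degree D w <= T)%N].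
have hn : (#|~: L| * T <= 2 * n)%N by exact: leq_trans (card_high_degree _ T) _.
have cNL : (#|N :&: L| < r * T.+1)%N.
  rewrite ltnNge; apply/negP => large.
  have [||||I [INL cI indI]] := @independent_subset _ D _ _ T r (N :&: L) => //.
  - exact: compl_rel_sym.
  - exact: compl_rel_irr.
  - by move=> w; rewrite !inE => /andP[_].
  - by apply: noI indI cI; exact: subset_trans INL (subsetIl _ _).
have cN : (#|N| <= #|N :&: L| + #|~: L|)%N.
  rewrite -(cardsID L N) leq_add2l; apply: subset_leq_card.
  by apply/subsetP => w /setDP[_ wL]; rewrite inE.
have : (#|~: L| * 32 <= #|~: L| * T)%N by rewrite leq_mul2l /T; lia.
have : (r * T.+1 <= 33 * (r.+1 * r.+1))%N by rewrite /T; nia.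
have : (0 < r.+1 * r.+1)%N by [].
lia.
Qed.
Local Open Scope nat_scope.

Theorem theorem5p5 (R : realType) (r : nat) (hr : (1 <= r)%N) :
  exists n0 : nat, forall (n : nat), (n0 <= n)%N -> (r.+1 %| n)%N ->
    forall G : rel 'I_n, simple_graph G ->
      ~ contains_subgraph (@copies_of_K (n %/ r.+1) r.+1) G ->
      (lambda R G <= lambda R (@H_adj n r))%R /\
      (lambda R G = lambda R (@H_adj n r) <-> graph_iso G (@H_adj n r)).
Proof.
(* From here on the graph has [n.+1] vertices. *)
exists (200 * (r.+1 * r.+1)) => -[|n]; first by rewrite leqn0 !muln_eq0.
move=> big dvd_n G simpleG noF; have [symG irrG] := simpleG.
have n_gt0 : 0 < n by lia.
set H := @H_adj n.+1 r; have symH : symmetric H by exact: H_adj_sym.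
have lamH : (n%:R - 1 <= lambda R H)%R by exact: lambda_H_lower.
have [lt_lam|ge_lam] := ltP (lambda R G) (lambda R H).
  split; first exact: ltW.
  by split=> [eq_lam|/(lambda_iso R symH) eq_lam]; move: lt_lam; rewrite eq_lam ltxx.
(* Such a [pendant v M] is a copy of [H], so comparing [G] with it settles both the bound and the
   equality case. *)
suff [M [v [vM cM leM eqM]]] : exists (M : {set 'I_n.+1}) v, [/\ v \notin M, #|M| = r.-1,
    (lambda R G <= lambda R (pendant v M))%R
    & lambda R G = lambda R (pendant v M) -> G =2 pendant v M].
  have isoM := pendant_iso vM cM.
  rewrite (lambda_iso R symH isoM) in leM eqM.
  split=> //; split=> [/eqM GM|]; last exact: lambda_iso.
  by have [s sM] := isoM; exists s => i j; rewrite GM sM.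
have lam_large := le_trans lamH ge_lam.
have [_ [x [x01 [top xtop] eigx]]] := lambda_perron R symG.
have x_ge0 i : (0 <= x i)%R by have /andP[] := x01 i.
pose D := compl_rel G.
have symD : symmetric D by exact: compl_rel_sym.
have irrD : irreflexive D by exact: compl_rel_irr.
have sum_deg : \sum_v degree D v <= 2 * n.
  exact: (sum_degree_compl simpleG n_gt0 x01 xtop eigx lam_large).
have deg_pair v w : v != w -> degree D v + degree D w <= n.+1.
  move=> vw; have := leq_add sum_deg (leqnn (2 * D v w)).
  by move=> /(leq_trans (degree_pair symD irrD vw)); case: (D v w) => /=; lia.
have [good|/boolp.existsNP[v bad]] := boolp.EM (forall v, exists I : {set 'I_n.+1},
    [/\ #|I| = r, independent D I, v \notin I & {in I, forall w, ~~ D v w}]).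
  case: noF; have := @tiled_contains _ G r.+1 isT; rewrite card_ord; apply.
  apply: tiling_of_few_edges; rewrite ?card_ord //.
  by apply: leq_trans sum_deg _; rewrite leq_mul2l leqnSn.
have noI (I : {set 'I_n.+1}) :
    I \subset [set w | G v w] -> independent D I -> #|I| <> r.
  move=> /subsetP IN indI cI; apply: bad; exists I; split=> //.
    by apply/negP => /IN; rewrite inE irrG.
  by move=> w /IN; rewrite inE /D /compl_rel => ->; rewrite andbF.
pose g := #|[set w | G v w]|.
have cN : 3 * g + 5 < n by exact: card_nbh_le big sum_deg noI.
have degN : g + degree D v = n by exact: degree_compl.
have sx : (0 < sqnorm x)%R.
  rewrite lt_def sqnorm_ge0 andbT; apply/eqP => /sqnorm_eq0/(_ top)/eqP.
  by rewrite xtop oner_eq0.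
have xv i : i != v -> (2 * x v < x i)%R.
  move=> iv; set lam1 := (lambda R G + 1)%R.
  have lower : (n%:R - (degree D i)%:R <= lam1 * x i)%R.
    by have := eigen_lower simpleG x01 xtop eigx lam_large i.
  have upper : (lam1 * x v <= n.+1%:R - (degree D v)%:R + 1)%R.
    by have := eigen_upper simpleG x01 xtop eigx lam_large v.
  have lam1_gt0 : (0 < lam1)%R.
    by have : (0 < n%:R :> R)%R; [rewrite ltr0n | rewrite /lam1; lra].
  (* By [deg_pair] the degree of [i] is at most [n.+1] minus that of [v], which is [n - g]; the
     inequality then amounts to [3 * g + 5 < n]. *)
  have : 2 * (n.+1 + 1) + degree D i < n + 2 * degree D v.
    by have := deg_pair i v iv; lia.
  rewrite -(ltr_nat R) !(natrD, natrM) => gap.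
  by rewrite -(ltr_pM2l lam1_gt0) mulrCA; lra.
have [|M MP] := lambda_pendant simpleG hr _ x_ge0 xv eigx sx noI; first lia.
by exists M, v.
Qed.
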